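(* If a dagger category $\mathbf{C}$ has all $(\mathbf{J},\Omega)$-shaped dagger limits and all $(\mathbf{K},\Psi)$-shaped dagger colimits, and $D\colon\mathbf{J}\times\mathbf{K}\to\mathbf{C}$ is an adjointable bifunctor, then the canonical morphism $$\tau\colon\operatorname{dcolim}^\Psi_k\operatorname{dlim}^\Omega_j D(j,k)\to\operatorname{dlim}^\Omega_j\operatorname{dcolim}^\Psi_k D(j,k)$$ is unitary.
   Context: A dagger category is a category $\mathbf{C}$ equipped with an identity-on-objects functor $\dagger\colon\mathbf{C}^{\mathrm{op}}\to\mathbf{C}$ satisfying $f^{\dagger\dagger}=f$. A morphism $f\colon A\to B$ is unitary if $f^\dagger f=\mathrm{id}_A$ and $ff^\dagger=\mathrm{id}_B$, and a partial isometry if $f=ff^\dagger f$. A class $\Omega$ of objects of $\mathbf{J}$ is weakly initial if every object of $\mathbf{J}$ receives a morphism from some object in $\Omega$. For a functor $E\colon\mathbf{J}\to\mathbf{C}$ and weakly initial $\Omega$, a dagger limit of $(E,\Omega)$, written $\operatorname{dlim}^\Omega_j E(j)$, is a limit $(L,l_j\colon L\to E(j))$ of $E$ such that $l_j$ is a partial isometry for all $j\in\Omega$ and $l_i^\dagger l_i l_j^\dagger l_j=l_j^\dagger l_j l_i^\dagger l_i$ for all $i,j\in\Omega$. $\mathbf{C}$ has all $(\mathbf{J},\Omega)$-shaped dagger limits if $(E,\Omega)$ has a dagger limit for every functor $E\colon\mathbf{J}\to\mathbf{C}$. $(\mathbf{K},\Psi)$-shaped dagger colimits are $(\mathbf{K}^{\mathrm{op}},\Psi)$-shaped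 dagger limits, where $\Psi$ is weakly initial in $\mathbf{K}^{\mathrm{op}}$. Explicitly, for $E\colon\mathbf{K}\to\mathbf{C}$, $\operatorname{dcolim}^\Psi_k E(k)$ is a dagger limit of $(E^\dagger,\Psi)$, where $E^\dagger\colon\mathbf{K}^{\mathrm{op}}\to\mathbf{C}$ is $E$ followed by the dagger ($E^\dagger(k)=E(k)$, $E^\dagger(g)=E(g)^\dagger$), viewed as a colimit of $E$ whose cocone consists of the daggers of the limiting cone. A bifunctor $D\colon\mathbf{J}\times\mathbf{K}\to\mathbf{C}$ is adjointable if for each $g\colon k\to h$ in $\mathbf{K}$ the natural transformation $D(-,g)\colon D(-,k)\Rightarrow D(-,h)$ is adjointable, i.e. the componentwise daggers $D(j,g)^\dagger$ form a natural transformation $D(-,h)\Rightarrow D(-,k)$. The assignments $k\mapsto\operatorname{dlim}^\Omega_jD(j,k)$ and $j\mapsto\operatorname{dcolim}^\Psi_kD(j,k)$ are made into functors via the universal properties of (co)limits. The canonical morphism $\tau$ is the unique morphism such that for all $j\in\mathbf{J}$ and $k\in\mathbf{K}$ the composite $$\operatorname{dlim}^\Omega_jD(j,k)\to\operatorname{dcolim}^\Psi_k\operatorname{dlim}^\Omega_jD(j,k)\xrightarrow{\tau}\operatorname{dlim}^\Omega_j\operatorname{dcolim}^\Psi_kD(j,k)\to\operatorname{dcolim}^\Psi_kD(j,k)$$ equals $\operatorname{dlim}^\Omega_jD(j,k)\to D(j,k)\to\operatorname{dcolim}^\Psi_kD(j,k)$, where the unlabelled morphisms are the structure maps of the limiting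 cones and colimiting cocones. *)

(* Defs.v *)
From Corelib Require Import ssreflect.

Set Implicit Arguments.
Unset Strict Implicit.
Unset Printing Implicit Defensive.

Declare Scope cat_scope.
Open Scope cat_scope.

Record category := Category {
  obj :> Type;
  hom : obj -> obj -> Type;
  idm : forall a, hom a a;
  comp : forall a b c, hom b c -> hom a b -> hom a c;
  compA : forall a b c d (h : hom c d) (g : hom b c) (f : hom a b),
    comp h (comp g f) = comp (comp h g) f;
  comp1m : forall a b (f : hom a b), comp (idm b) f = f;
  compm1 : forall a b (f : hom a b), comp f (idm a) = f
}.

Arguments hom {_} _ _.
Arguments idm {_} _.
Arguments comp {_ _ _ _} _ _ : rename.

Notation "g ∘ f" := (comp g f) (at level 40, left associativity) : cat_scope.

Definition opposite (C : category) : category :=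
  @Category C (fun a b => @hom C b a) (fun a => idm a)
    (fun a b c g f => f ∘ g)
    (fun a b c d h g f => eq_sym (compA f g h))
    (fun a b f => compm1 f) (fun a b f => comp1m f).

Definition product (J K : category) : category.
Proof.
refine (@Category (J * K)
  (fun x y => (hom (fst x) (fst y) * hom (snd x) (snd y))%type)
  (fun x => (idm (fst x), idm (snd x)))
  (fun x y z g f => (fst g ∘ fst f, snd g ∘ snd f)) _ _ _).
- by move=> *; rewrite /= !compA.
- by move=> a b [f g]; rewrite /= !comp1m.
- by move=> a b [f g]; rewrite /= !compm1.
Defined.

Record functor (J C : category) := Functor {
  fobj :> J -> C;
  fmap : forall i j, hom i j -> hom (fobj i) (fobj j);
  fmap1 : forall j, fmap (idm j) = idm (fobj j);
  fmapM : forall i j k (g : hom j k) (f : hom i j),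
    fmap (g ∘ f) = fmap g ∘ fmap f
}.

Arguments fmap {_ _} _ {_ _} _.

Definition is_natural (J C : category) (E F : functor J C)
    (s : forall j, hom (E j) (F j)) : Prop :=
  forall i j (f : hom i j), s j ∘ fmap E f = fmap F f ∘ s i.

Record nat_trans (J C : category) (E F : functor J C) := NatTrans {
  component :> forall j, hom (E j) (F j);
  component_natural : is_natural component
}.

Section Limits.
Variables (J C : category) (E : functor J C).

Record cone (X : C) := Cone {
  leg :> forall j, hom X (E j);
  legP : forall i j (f : hom i j), fmap E f ∘ leg i = leg j
}.

Record limit := Limit {
  lim_apex :> C;
  lim_cone : cone lim_apex;
  lim_lift : forall X, cone X -> hom X lim_apex;
  lim_liftP : forall X (c : cone X) j, lim_cone j ∘ lim_lift c = c j;
  lim_lift_unique : forall X (c : cone X) (m : hom X lim_apex),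
    (forall j, lim_cone j ∘ m = c j) -> m = lim_lift c
}.

Record cocone (X : C) := Cocone {
  coleg :> forall j, hom (E j) X;
  colegP : forall i j (f : hom i j), coleg j ∘ fmap E f = coleg i
}.

Record colimit := Colimit {
  colim_apex :> C;
  colim_cocone : cocone colim_apex;
  colim_desc : forall X, cocone X -> hom colim_apex X;
  colim_descP : forall X (c : cocone X) j,
    colim_desc c ∘ colim_cocone j = c j;
  colim_desc_unique : forall X (c : cocone X) (m : hom colim_apex X),
    (forall j, m ∘ colim_cocone j = c j) -> m = colim_desc c
}.

Lemma lim_ext (L : limit) X (m n : hom X L) :
  (forall j, lim_cone L j ∘ m = lim_cone L j ∘ n) -> m = n.
Proof.
move=> mn.
have cP i j (f : hom i j) :
    fmap E f ∘ (lim_cone L i ∘ n) = lim_cone L j ∘ n.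
  by rewrite compA legP.
by rewrite (lim_lift_unique (c := Cone cP) (m := n)) //;
  apply: lim_lift_unique.
Qed.

Lemma colim_ext (L : colimit) X (m n : hom L X) :
  (forall j, m ∘ colim_cocone L j = n ∘ colim_cocone L j) -> m = n.
Proof.
move=> mn.
have cP i j (f : hom i j) :
    n ∘ colim_cocone L j ∘ fmap E f = n ∘ colim_cocone L i.
  by rewrite -compA colegP.
by rewrite (colim_desc_unique (c := Cocone cP) (m := n)) //;
  apply: colim_desc_unique.
Qed.

End Limits.

Arguments lim_cone {_ _ _} _.
Arguments lim_lift {_ _ _} _ {_} _.
Arguments colim_cocone {_ _ _} _.
Arguments colim_desc {_ _ _} _ {_} _.

Section Bifunctors.
Variables (J K C : category) (D : functor (product J K) C).

(* D(f, k) and D(j, g) *)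
Definition fmapl i j (f : hom i j) (k : K) : hom (D (i, k)) (D (j, k)) :=
  @fmap _ _ D (i, k) (j, k) (f, idm k).

Definition fmapr (j : J) k h (g : hom k h) : hom (D (j, k)) (D (j, h)) :=
  @fmap _ _ D (j, k) (j, h) (idm j, g).

Lemma fmaplr i j (f : hom i j) k h (g : hom k h) :
  fmapr j g ∘ fmapl f k = fmapl f h ∘ fmapr i g.
Proof. by rewrite /fmapl /fmapr -!fmapM /= !comp1m !compm1. Qed.

Lemma fmapl1 j k : fmapl (idm j) k = idm (D (j, k)).
Proof. by rewrite /fmapl -(fmap1 D). Qed.

Lemma fmapr1 j k : fmapr j (idm k) = idm (D (j, k)).
Proof. by rewrite /fmapr -(fmap1 D). Qed.

Lemma fmaplM i j l (g : hom j l) (f : hom i j) k :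
  fmapl (g ∘ f) k = fmapl g k ∘ fmapl f k.
Proof. by rewrite /fmapl -fmapM /= comp1m. Qed.

Lemma fmaprM j k h l (g : hom h l) (f : hom k h) :
  fmapr j (g ∘ f) = fmapr j g ∘ fmapr j f.
Proof. by rewrite /fmapr -fmapM /= comp1m. Qed.

(* D(-, k) *)
Definition slicel (k : K) : functor J C :=
  @Functor J C (fun j => D (j, k)) (fun i j f => fmapl f k)
    (fun j => fmapl1 j k) (fun i j l g f => fmaplM g f k).

(* D(j, -) *)
Definition slicer (j : J) : functor K C :=
  @Functor K C (fun k => D (j, k)) (fun k h g => fmapr j g)
    (fmapr1 j) (fun k h l g f => fmaprM j g f).

(* D(-, g) : D(-, k) => D(-, h) *)
Definition slicel_trans k h (g : hom k h) : nat_trans (slicel k) (slicel h) :=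
  @NatTrans J C (slicel k) (slicel h) (fun j => fmapr j g)
    (fun i j f => fmaplr f g).

Section LimFunctor.
Variable L : forall k, limit (slicel k).

Definition lim_map_cone k h (g : hom k h) : cone (slicel h) (L k).
Proof.
refine (@Cone _ _ (slicel h) (L k) (fun j => fmapr j g ∘ lim_cone (L k) j) _).
by move=> i j f; rewrite /= compA -fmaplr -compA (legP (lim_cone (L k)) f).
Defined.

(* k |-> lim_j D(j, k) *)
Definition lim_functor : functor K C.
Proof.
refine (@Functor K C (fun k => L k)
  (fun k h g => lim_lift (L h) (lim_map_cone g)) _ _).
- move=> k; apply: lim_ext => j.
  by rewrite lim_liftP /= fmapr1 comp1m compm1.
- move=> k h l g f; apply: lim_ext => j.
  by rewrite compA !lim_liftP /= -compA lim_liftP /= compA fmaprM.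
Defined.

End LimFunctor.

Section ColimFunctor.
Variable M : forall j, colimit (slicer j).

Definition colim_map_cocone i j (f : hom i j) : cocone (slicer i) (M j).
Proof.
refine (@Cocone _ _ (slicer i) (M j)
  (fun k => colim_cocone (M j) k ∘ fmapl f k) _).
by move=> k h g; rewrite /= -compA -fmaplr compA (colegP (colim_cocone (M j)) g).
Defined.

(* j |-> colim_k D(j, k) *)
Definition colim_functor : functor J C.
Proof.
refine (@Functor J C (fun j => M j)
  (fun i j f => colim_desc (M i) (colim_map_cocone f)) _ _).
- move=> j; apply: colim_ext => k.
  by rewrite colim_descP /= fmapl1 comp1m compm1.
- move=> i j l g f; apply: colim_ext => k.
  rewrite -compA !colim_descP /= compA.
  rewrite [X in _ = X ∘ _](colim_descP (M j) (colim_map_cocone g) k) /=.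
  by rewrite -compA fmaplM.
Defined.

End ColimFunctor.

Section Tau.
Variables (L : forall k, limit (slicel k)) (M : forall j, colimit (slicer j)).
Variables (P : colimit (lim_functor L)) (Q : limit (colim_functor M)).

Definition tau_cocone (j : J) : cocone (lim_functor L) (M j).
Proof.
refine (@Cocone _ _ (lim_functor L) (M j)
  (fun k => colim_cocone (M j) k ∘ lim_cone (L k) j) _).
move=> k h g; rewrite /= -compA lim_liftP /= compA.
by rewrite (colegP (colim_cocone (M j)) g).
Defined.

Definition tau_cone : cone (colim_functor M) P.
Proof.
refine (@Cone _ _ (colim_functor M) P
  (fun j => colim_desc P (tau_cocone j)) _).
move=> i j f; apply: colim_ext => k.
rewrite -compA !colim_descP /= compA.
rewrite [X in X ∘ _ = _](colim_descP (M i) (colim_map_cocone M f) k) /= -compA.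
by rewrite (legP (lim_cone (L k)) f).
Defined.

Definition tau : hom P Q := lim_lift Q tau_cone.

Lemma tauP j k :
  lim_cone Q j ∘ tau ∘ colim_cocone P k =
  colim_cocone (M j) k ∘ lim_cone (L k) j.
Proof. by rewrite lim_liftP colim_descP. Qed.

Lemma tau_unique (t : hom P Q) :
  (forall j k, lim_cone Q j ∘ t ∘ colim_cocone P k =
    colim_cocone (M j) k ∘ lim_cone (L k) j) -> t = tau.
Proof.
move=> tP; apply: lim_ext => j; apply: colim_ext => k.
by rewrite tauP; apply: tP.
Qed.

End Tau.
End Bifunctors.

Record dagger_category := DaggerCategory {
  dcat :> category;
  dag : forall a b : dcat, hom a b -> hom b a;
  dag1 : forall a : dcat, dag (idm a) = idm a;
  dagM : forall (a b c : dcat) (g : hom b c) (f : hom a b),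
    dag (g ∘ f) = dag f ∘ dag g;
  dagK : forall (a b : dcat) (f : hom a b), dag (dag f) = f
}.

Arguments dag {_ _ _} _.

Notation "f ^†" := (dag f) (at level 2, left associativity, format "f ^†")
  : cat_scope.

Definition unitary (C : dagger_category) (a b : C) (f : hom a b) : Prop :=
  f^† ∘ f = idm a /\ f ∘ f^† = idm b.

Definition partial_isometry (C : dagger_category) (a b : C) (f : hom a b) :
  Prop := f = f ∘ f^† ∘ f.

Definition weakly_initial (J : category) (Omega : J -> Prop) : Prop :=
  forall j : J, exists i : J, Omega i /\ inhabited (hom i j).

Record dagger_limit (J : category) (C : dagger_category) (E : functor J C)
    (Omega : J -> Prop) := DaggerLimit {
  dlim_limit :> limit E;
  dlim_isometry : forall j, Omega j -> partial_isometry (lim_cone dlim_limit j);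
  dlim_commute : forall i j, Omega i -> Omega j ->
    let l := lim_cone dlim_limit in
    (l i)^† ∘ l i ∘ ((l j)^† ∘ l j) = (l j)^† ∘ l j ∘ ((l i)^† ∘ l i)
}.

Definition has_dagger_limits (J : category) (Omega : J -> Prop)
    (C : dagger_category) : Prop :=
  forall E : functor J C, inhabited (dagger_limit E Omega).

Section DaggerColimits.
Variables (K : category) (C : dagger_category).

Definition dagger_functor (E : functor K C) : functor (opposite K) C.
Proof.
refine (@Functor (opposite K) C (fun k => E k)
  (fun k h (g : @hom K h k) => (fmap E g)^†) _ _).
- by move=> k; rewrite fmap1 dag1.
- by move=> k h l g f; rewrite -dagM -fmapM.
Defined.

Definition dagger_colimit (E : functor K C) (Psi : K -> Prop) : Type :=
  @dagger_limit (opposite K) C (dagger_functor E) Psi.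

Definition has_dagger_colimits (Psi : K -> Prop) : Prop :=
  forall E : functor K C, inhabited (dagger_colimit E Psi).

Variable E : functor K C.

Definition dagger_cone (X : C) (c : cocone E X) : cone (dagger_functor E) X.
Proof.
refine (@Cone (opposite K) C (dagger_functor E) X (fun k => (c k)^†) _).
by move=> k h g; rewrite /= -dagM (colegP c g).
Defined.

Definition dagger_cocone (X : C) (c : cone (dagger_functor E) X) : cocone E X.
Proof.
refine (@Cocone K C E X (fun k => (c k)^†) _).
by move=> k h g; rewrite -(legP c (g : @hom (opposite K) h k)) /= dagM dagK.
Defined.

Definition dcolim_colimit (Psi : K -> Prop) (M : dagger_colimit E Psi) :
  colimit E.
Proof.
refine (@Colimit K C E M (dagger_cocone (lim_cone M))
  (fun X c => (lim_lift M (dagger_cone c))^†) _ _).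
- by move=> X c k; rewrite /= -dagM lim_liftP /= dagK.
- move=> X c m mP; rewrite -[m]dagK; congr dag; apply: lim_lift_unique => k.
  by rewrite /= -mP dagM /= dagK.
Defined.

End DaggerColimits.

Arguments has_dagger_colimits K C Psi : clear implicits.

Definition adjointable (J : category) (C : dagger_category)
    (E F : functor J C) (s : nat_trans E F) : Prop :=
  is_natural (E := F) (F := E) (fun j => (s j)^†).

Definition adjointable_bifunctor (J K : category) (C : dagger_category)
    (D : functor (product J K) C) : Prop :=
  forall (k h : K) (g : hom k h), adjointable (slicel_trans D g).

(* Main.v *)
Require Import Defs.
From Corelib Require Import ssreflect.

(** Everything rests on one fact, [dagger_lim_map]: dagger limits send
    adjointable transformations to their daggers.  If [σ : E ⇒ F] and its
    componentwise dagger are both natural, the map [s] that [σ] induces between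
    dagger limits satisfies [(lim σ)^† = lim (σ^†)].  For a single leg this is a
    computation with the projections [e j = l_j^† l_j] and [p j = m_j^† m_j],
    which gives [p j ∘ s = t^† ∘ e j] with [t = lim (σ^†)]; the commutation of
    the projections then glues these identities into [s^† = t]
    ([induced_maps_adjoint]).

    Write [l] and [m] for the legs of [lim_j D(j, k)] and of the dagger limit
    underlying [colim_k D(j, k)], so that the cocone legs of the latter are the
    [m^†], and [p], [q] for the outer legs.  Applied to [D(-, g)] and to
    [D(f, -)^†], the fact says that each leg [l j] is adjointable in [k] and each
    leg [m k] is adjointable in [j].  Applied again to these two families of
    legs, it turns the defining equation [q j ∘ τ ∘ (p k)^† = (m k)^† ∘ l j] into
    [m k ∘ q j ∘ τ = l j ∘ p k] and [l j ∘ p k ∘ τ^† = m k ∘ q j].  In other words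
    both iterated constructions are limits of the diagram on [J × K^op] obtained
    from [D] by the dagger in the second variable, and [τ] and [τ^†] are the two
    comparison maps of cones; hence they are mutually inverse. *)

Set Implicit Arguments.
Unset Strict Implicit.
Unset Printing Implicit Defensive.

(** * Dagger limits and adjointable transformations *)

Section DaggerLimits.
Variables (C : dagger_category) (J : category) (Omega : J -> Prop).
Hypothesis Omega_initial : weakly_initial Omega.

Lemma lim_ext_weakly_initial (E : functor J C) (L : limit E) (X : C)
    (f g : hom X L) :
  (forall j, Omega j -> lim_cone L j ∘ f = lim_cone L j ∘ g) -> f = g.
Proof.
move=> fg; apply: lim_ext => j.
have [i [Oi [u]]] := Omega_initial j.
by rewrite -(legP (lim_cone L) u) -!compA fg.
Qed.

(** The projection onto the part of the limit that the leg [j] sees. *)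
Definition support (E : functor J C) (L : dagger_limit E Omega) (j : J) :
  hom L L := (lim_cone L j)^† ∘ lim_cone L j.

Section Projections.
Variables (E : functor J C) (L : dagger_limit E Omega).

Lemma support_dag j : (support L j)^† = support L j.
Proof. by rewrite /support dagM dagK. Qed.

Lemma leg_support j : Omega j -> lim_cone L j ∘ support L j = lim_cone L j.
Proof. by move=> Oj; rewrite /support compA -(dlim_isometry L Oj). Qed.

Lemma support_idem j : Omega j -> support L j ∘ support L j = support L j.
Proof. by move=> Oj; rewrite {1}/support -compA leg_support. Qed.

Lemma support_comm i j : Omega i -> Omega j ->
  support L i ∘ support L j = support L j ∘ support L i.
Proof. by move=> Oi Oj; apply: (dlim_commute L Oi Oj). Qed.

(** A leg is recovered from its projection, so the projections are jointly
    monic because the legs are. *)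
Lemma support_jointly_monic (X : C) (f g : hom X L) :
  (forall j, Omega j -> support L j ∘ f = support L j ∘ g) -> f = g.
Proof.
move=> fg; apply: lim_ext_weakly_initial => j Oj.
by rewrite -(leg_support Oj) -(compA _ _ f) -(compA _ _ g) fg.
Qed.

End Projections.

Section InducedMaps.
Variables (E F : functor J C).
Variables (L : dagger_limit E Omega) (M : dagger_limit F Omega).
Variable sigma : forall j, hom (E j) (F j).

Variables (s : hom L M) (t : hom M L).
Hypothesis legs_s : forall j, Omega j ->
  lim_cone M j ∘ s = sigma j ∘ lim_cone L j.
Hypothesis legs_t : forall j, Omega j ->
  lim_cone L j ∘ t = (sigma j)^† ∘ lim_cone M j.

(** Both sides are [m_j^† ∘ sigma j ∘ l_j]: this is [s^† = t] seen through a
    single leg. *)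
Lemma support_adjoint j : Omega j ->
  support M j ∘ s = t^† ∘ support L j.
Proof.
move=> Oj; rewrite -(support_dag L) -dagM /support -!compA legs_s // legs_t //.
by rewrite !dagM !dagK compA.
Qed.

(** By [support_adjoint] and the commutation of the projections of [L],
    [support M j ∘ s ∘ support L k] is symmetric in [j] and [k], hence absorbs
    [support M k] as well as [support M j] on the left. *)
Lemma support_intertwined k : Omega k ->
  s ∘ support L k = support M k ∘ s.
Proof.
move=> Ok.
have s_supported : support M k ∘ s ∘ support L k = support M k ∘ s.
  by rewrite support_adjoint // -compA support_idem.
apply: support_jointly_monic => j Oj.
have swap : support M j ∘ s ∘ support L k = support M k ∘ s ∘ support L j.
  by rewrite !support_adjoint // -(compA t^†) support_comm // compA.
have absorb : support M k ∘ (support M j ∘ s ∘ support L k) =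
    support M j ∘ s ∘ support L k.
  by rewrite swap 2!(compA (support M k)) support_idem.
rewrite -[in RHS]s_supported compA -absorb 3!(compA (support M _)).
by rewrite (compA (support M j)) support_comm.
Qed.

Lemma induced_maps_adjoint : s^† = t.
Proof.
apply: support_jointly_monic => k Ok.
rewrite -(support_dag L) -dagM support_intertwined // support_adjoint //.
by rewrite dagM dagK.
Qed.

End InducedMaps.

Theorem dagger_lim_map (E F : functor J C) (L : dagger_limit E Omega)
    (M : dagger_limit F Omega) (sigma : nat_trans E F) (s : hom L M) :
  adjointable sigma ->
  (forall j, lim_cone M j ∘ s = sigma j ∘ lim_cone L j) ->
  forall j, lim_cone L j ∘ s^† = (sigma j)^† ∘ lim_cone M j.
Proof.
move=> adj legs_s.
have legP' i j (f : hom i j) :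
    fmap E f ∘ ((sigma i)^† ∘ lim_cone M i) = (sigma j)^† ∘ lim_cone M j.
  by rewrite compA -adj -compA legP.
have legs_t := lim_liftP L (Cone legP').
rewrite (@induced_maps_adjoint E F L M sigma s (lim_lift L (Cone legP'))) //.
Qed.

End DaggerLimits.

(** * Dagger limits against dagger colimits *)

Section Interchange.
Variables (C : dagger_category) (J K : category).
Variables (Omega : J -> Prop) (Psi : K -> Prop).
Hypothesis Omega_initial : weakly_initial Omega.
Hypothesis Psi_initial : @weakly_initial (opposite K) Psi.
Variable D : functor (product J K) C.
Hypothesis D_adjointable : adjointable_bifunctor D.
Variable L : forall k : K, dagger_limit (slicel D k) Omega.
Variable M : forall j : J, dagger_colimit (slicer D j) Psi.

Let LF := lim_functor (fun k => L k).
Let MF := colim_functor (fun j => dcolim_colimit (M j)).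

Lemma lim_functor_leg k h (g : hom k h) j :
  lim_cone (L h) j ∘ fmap LF g = fmapr D j g ∘ lim_cone (L k) j.
Proof. by rewrite lim_liftP. Qed.

Lemma colim_functor_coleg i j (f : hom i j) k :
  fmap MF f ∘ (lim_cone (M i) k)^† = (lim_cone (M j) k)^† ∘ fmapl D f k.
Proof.
exact: (colim_descP (dcolim_colimit (M i))
  (colim_map_cocone (fun j => dcolim_colimit (M j)) f) k).
Qed.

(** The dagger of [lim_j D(j, g)] is the limit of the daggers, by
    [dagger_lim_map] for [D(-, g)]. *)
Lemma lim_functor_dag_leg k h (g : hom k h) j :
  lim_cone (L k) j ∘ (fmap LF g)^† = (fmapr D j g)^† ∘ lim_cone (L h) j.
Proof.
apply: (dagger_lim_map Omega_initial (D_adjointable g)) => i.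
exact: lim_functor_leg.
Qed.

(** The dual fact for [colim_k D(f, k)], by [dagger_lim_map] for [D(f, -)^†],
    which is adjointable because [D] is. *)
Lemma colim_functor_leg i j (f : hom i j) k :
  lim_cone (M j) k ∘ fmap MF f = fmapl D f k ∘ lim_cone (M i) k.
Proof.
have nat : is_natural (E := dagger_functor (slicer D j))
    (F := dagger_functor (slicer D i)) (fun k => (fmapl D f k)^†).
  by move=> h k' g; rewrite /= -!dagM fmaplr.
have adj : adjointable (NatTrans nat).
  by move=> h k' g; rewrite /= !dagK (D_adjointable g f).
have legs (h : opposite K) : lim_cone (M i) h ∘ (fmap MF f)^† =
    (fmapl D f h)^† ∘ lim_cone (M j) h.
  by rewrite -{1}[lim_cone (M i) h]dagK -dagM colim_functor_coleg dagM dagK.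
have := dagger_lim_map Psi_initial adj legs k.
by rewrite /= !dagK.
Qed.

Variable P : dagger_colimit LF Psi.
Variable Q : dagger_limit MF Omega.

Let t : hom P Q := tau (dcolim_colimit P) Q.

Lemma tau_legs j k :
  lim_cone Q j ∘ t ∘ (lim_cone P k)^† = (lim_cone (M j) k)^† ∘ lim_cone (L k) j.
Proof. exact: (tauP (dcolim_colimit P) Q j k). Qed.

(** The legs [L k -> D(j, k)] are adjointable in [k], so [dagger_lim_map] turns
    the equation that defines [q j ∘ τ] on the cocone of [P] into one on the
    cone of [M j]. *)
Lemma leg_tau j k :
  lim_cone (M j) k ∘ (lim_cone Q j ∘ t) = lim_cone (L k) j ∘ lim_cone P k.
Proof.
have nat : is_natural (E := dagger_functor (slicer D j))
    (F := dagger_functor LF) (fun k => (lim_cone (L k) j)^†).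
  by move=> h k' g; rewrite /= -!dagM lim_functor_leg.
have adj : adjointable (NatTrans nat).
  by move=> h k' g; rewrite /= !dagK lim_functor_dag_leg.
have legs (h : opposite K) : lim_cone P h ∘ (lim_cone Q j ∘ t)^† =
    (lim_cone (L h) j)^† ∘ lim_cone (M j) h.
  by rewrite -{1}[lim_cone P h]dagK -dagM tau_legs dagM dagK.
have := dagger_lim_map Psi_initial adj legs k.
by rewrite /= !dagK.
Qed.

(** Dually, the cocone legs [D(j, k) -> M j] are adjointable in [j]. *)
Lemma leg_tau_dag j k :
  lim_cone (L k) j ∘ (lim_cone P k ∘ t^†) = lim_cone (M j) k ∘ lim_cone Q j.
Proof.
have nat : is_natural (E := slicel D k) (F := MF)
    (fun j => (lim_cone (M j) k)^†).
  by move=> i j' f; rewrite /= -colim_functor_coleg.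
have adj : adjointable (NatTrans nat).
  by move=> i j' f; rewrite /= !dagK -colim_functor_leg.
have legs i : lim_cone Q i ∘ (t ∘ (lim_cone P k)^†) =
    (lim_cone (M i) k)^† ∘ lim_cone (L k) i.
  by rewrite compA tau_legs.
have := dagger_lim_map Omega_initial adj legs j.
by rewrite /= dagM !dagK.
Qed.

Lemma tau_unitary : unitary t.
Proof.
split.
- apply: (lim_ext (L := P)) => k; apply: (lim_ext (L := L k)) => j.
  by rewrite !compA -(compA _ _ t^†) leg_tau_dag compm1 -leg_tau compA.
- apply: (lim_ext (L := Q)) => j; apply: (lim_ext (L := M j)) => k.
  by rewrite !compA -(compA _ _ t) leg_tau compm1 -leg_tau_dag compA.
Qed.

End Interchange.

Theorem theorem9p5 (C : dagger_category) (J K : category)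
    (Omega : J -> Prop) (Psi : K -> Prop)
    (hOmega : weakly_initial Omega)
    (hPsi : @weakly_initial (opposite K) Psi)
    (hJ : has_dagger_limits Omega C)
    (hK : has_dagger_colimits K C Psi)
    (D : functor (product J K) C)
    (hD : adjointable_bifunctor D)
    (L : forall k : K, dagger_limit (slicel D k) Omega)
    (M : forall j : J, dagger_colimit (slicer D j) Psi)
    (P : dagger_colimit (lim_functor (fun k => L k)) Psi)
    (Q : dagger_limit (colim_functor (fun j => dcolim_colimit (M j))) Omega) :
  unitary (tau (dcolim_colimit P) Q).
Proof. exact: tau_unitary. Qed.
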